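(* Let $(X,d,A)$ be a metric pair where $A$ is not isolated, and let $p\in[1,\infty]$. Then no element of $(\overline{D}_p(X,A),W_p)$ has a compact neighborhood. Hence $(\overline{D}_p(X,A),W_p)$ is not locally compact, and every compact subset of it has empty interior.
   Context: A metric on $X$ is a map $d:X\times X\to[0,\infty]$ with $d(x,x)=0$, symmetry and the triangle inequality (infinite distances allowed, $d(x,y)=0$ need not imply $x=y$); a metric pair $(X,d,A)$ is such a space with a closed subset $A$. Write $d(x,A)=\inf_{a\in A}d(x,a)$ and $A^\delta=\{x:d(x,A)<\delta\}$ for $\delta\in(0,\infty]$. $A$ is isolated if there is $\delta>0$ with $A^\delta=A$. $\overline{D}(X,A)$ is the set of countable formal sums $\hat\alpha=\sum_{i\in I}x_i$ of points of $X\setminus A$ (repetitions allowed); $0$ the empty sum. A matching of $\hat\alpha=\sum_{i\in I}x_i$, $\hat\beta=\sum_{j\in J}y_j$ is a formal sum $\sum_{k\in K}(x_k,y_{\varphi(k)})+\sum_{i\in I\setminus K}(x_i,z_i)+\sum_{j\in J\setminus\varphi(K)}(w_j,y_j)$ with $K\subset I$, $\varphi$ injective, $z_i,w_j\in A$; its $p$-cost is the $\ell^p$ norm (sup norm if $p=\infty$) of the distances of paired points; $W_p$ is the infimum of $p$-costs. $u_\delta(\alpha)$, $\ell_\delta(\alpha)$ are the restrictions of $\hat\alpha$ to $X\setminus A^\delta$ and to $A^\delta\setminus A$. For $p<\infty$, $\overline{D}_p(X,A)=\{\alpha: |u_\infty(\alpha)|<\infty,\ W_p(\ell_\infty(\alpha),0)<\infty\}$;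 $\overline{D}_\infty(X,A)=\{\alpha:|u_\delta(\alpha)|<\infty\ \forall\delta>0\}$. *)

(* Defs.v *)
From HB Require Import structures.
From mathcomp Require Import all_boot all_order all_algebra.
From mathcomp Require Import all_classical all_reals all_analysis.
Set Implicit Arguments. Unset Strict Implicit. Unset Printing Implicit Defensive.
Import Order.TTheory GRing.Theory Num.Theory.
Local Open Scope classical_set_scope.
Local Open Scope ring_scope.
Local Open Scope ereal_scope.

Section Defs.
Variables (R : realType) (X : Type).

Definition is_metric (d : X -> X -> \bar R) : Prop :=
  [/\ forall x y, 0 <= d x y, forall x, d x x = 0,
      forall x y, d x y = d y x &
      forall x y z, d x z <= d x y + d y z].

Definition dist_to (d : X -> X -> \bar R) (A : set X) (x : X) : \bar R :=
  ereal_inf [set d x a | a in A].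

Definition thick (d : X -> X -> \bar R) (A : set X) (delta : \bar R) : set X :=
  [set x | dist_to d A x < delta].

Definition is_closed_in (d : X -> X -> \bar R) (A : set X) : Prop :=
  forall x, (forall eps : R, (0 < eps)%R -> exists2 a, A a & d x a < eps%:E) -> A x.

Definition metric_pair (d : X -> X -> \bar R) (A : set X) : Prop :=
  is_metric d /\ is_closed_in d A.

Definition isolated_subset (d : X -> X -> \bar R) (A : set X) : Prop :=
  exists2 delta : \bar R, 0 < delta & thick d A delta = A.

(* A countable formal sum sum_{i in I} x_i, with I a subset of nat
   (every countable index set can be reindexed into nat). *)
Record fsum := FSum { idx : set nat; pt : nat -> X }.

(* the empty formal sum 0 (index set empty; the point map is irrelevant,
   we borrow that of a given sum since X may be empty) *)
Definition zero_like (a : fsum) : fsum := FSum set0 (pt a).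

Definition in_Dbar (A : set X) (a : fsum) : Prop :=
  forall i, idx a i -> ~ A (pt a i).

Definition restrict (a : fsum) (S : set X) : fsum :=
  FSum (idx a `&` [set i | S (pt a i)]) (pt a).

Variables (d : X -> X -> \bar R) (A : set X).

Definition u_ (delta : \bar R) (a : fsum) : fsum := restrict a (~` thick d A delta).
Definition l_ (delta : \bar R) (a : fsum) : fsum := restrict a (thick d A delta `\` A).

(* (K, phi, z, w) is a matching of a and b:
   sum_{k in K} (x_k, y_phi(k)) + sum_{i in I\K} (x_i, z_i) + sum_{j in J\phi(K)} (w_j, y_j) *)
Definition is_matching (a b : fsum) (K : set nat) (phi : nat -> nat)
    (z w : nat -> X) : Prop :=
  [/\ K `<=` idx a, set_inj K phi, phi @` K `<=` idx b,
      forall i, (idx a `\` K) i -> A (z i) &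
      forall j, (idx b `\` phi @` K) j -> A (w j)].

Definition mcost (p : \bar R) (a b : fsum) (K : set nat) (phi : nat -> nat)
    (z w : nat -> X) : \bar R :=
  match p with
  | r%:E => poweR
      ((\esum_(k in K) poweR (d (pt a k) (pt b (phi k))) r)
       + (\esum_(i in idx a `\` K) poweR (d (pt a i) (z i)) r)
       + (\esum_(j in idx b `\` phi @` K) poweR (d (w j) (pt b j)) r)) r^-1
  | _ => ereal_sup ([set 0] `|` [set d (pt a k) (pt b (phi k)) | k in K]
                    `|` [set d (pt a i) (z i) | i in idx a `\` K]
                    `|` [set d (w j) (pt b j) | j in idx b `\` phi @` K])
  end.

Definition Wp (p : \bar R) (a b : fsum) : \bar R :=
  ereal_inf [set c | exists K phi z w,
                is_matching a b K phi z w /\ c = mcost p a b K phi z w].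

Definition Dp (p : \bar R) : set fsum :=
  [set a | in_Dbar A a /\
     if p is +oo then
       forall delta : R, (0 < delta)%R -> finite_set (idx (u_ delta%:E a))
     else
       finite_set (idx (u_ +oo a)) /\ Wp p (l_ +oo a) (zero_like a) < +oo].

Definition Wball (p : \bar R) (a : fsum) (r : R) : set fsum :=
  [set b | Dp p b /\ Wp p a b < r%:E].

Definition Wopen (p : \bar R) (U : set fsum) : Prop :=
  U `<=` Dp p /\ forall b, U b -> exists2 r : R, (0 < r)%R & Wball p b r `<=` U.

Definition Wnbhd (p : \bar R) (a : fsum) (N : set fsum) : Prop :=
  N `<=` Dp p /\ exists U, [/\ Wopen p U, U a & U `<=` N].

Definition Wcompact (p : \bar R) (K : set fsum) : Prop :=
  K `<=` Dp p /\
  forall C : set (set fsum), (forall U, C U -> Wopen p U) ->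
    K `<=` \bigcup_(U in C) U ->
    exists F : set (set fsum), [/\ finite_set F, F `<=` C & K `<=` \bigcup_(U in F) U].

Definition Winterior (p : \bar R) (K : set fsum) : set fsum :=
  [set a | exists U, [/\ Wopen p U, U a & U `<=` K]].

Definition Wlocally_compact (p : \bar R) : Prop :=
  forall a, Dp p a -> exists N, Wnbhd p a N /\ Wcompact p N.

End Defs.

(* Main.v *)
(* Every ball about a sum a contains a + m x for a point x outside A close to A
   and a suitable multiplicity m.  A compact set containing the ball would be
   covered by a single member of an increasing open cover of D_p, and covers are
   chosen to be violated by these sums.  For p = oo: the sums with at most n
   points at distance >= t from A, for some t < s, where s = d(x, A).  For
   p < oo: the sums for which the points at distance < t from A, for some
   t > 1/(n+1), have total d(., A)^p below a fixed e.  Existentially quantifying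
   the threshold t makes these sets visibly open, so that the triangle inequality
   for W_p (Minkowski) is never needed. *)
Require Import Defs.
From HB Require Import structures.
From mathcomp Require Import all_boot all_order all_algebra.
From mathcomp Require Import all_classical all_reals all_analysis.
From mathcomp Require Import lra.
Import Order.TTheory GRing.Theory Num.Theory.
Local Open Scope classical_set_scope.
Local Open Scope ring_scope.
Local Open Scope ereal_scope.

(** * Finite sets of indices *)

Lemma finite_set_nat_bounded (D : set nat) :
  finite_set D -> exists n, D `<=` `I_n.
Proof.
move=> Dfin; exists (\max_(i <- finmap.enum_fset (fset_set D)) i).+1 => k Dk /=.
by rewrite ltnS; apply: leq_bigmax_seq; rewrite ?in_fset_set ?inE.
Qed.

(** Serves to find a threshold below the distances to [A] of finitely many points. *)
Lemma finite_set_gt0_lbound {R : realType} (D : set nat) (g : nat -> \bar R) :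
  finite_set D -> (forall i, D i -> 0 < g i) ->
  exists2 e : R, (0 < e)%R & forall i, D i -> e%:E <= g i.
Proof.
move=> /finite_set_nat_bounded[n Dn] g0.
have [e e0 eg] : exists2 e : R, (0 < e)%R & forall i, (i < n)%N -> D i -> e%:E <= g i.
  elim: n {Dn} => [|n [e e0 eg]]; first by exists 1%R.
  have [Dn|nDn] := pselect (D n); last first.
    by exists e => // i; rewrite ltnS leq_eqVlt => /predU1P[->//|]; exact: eg.
  have [e' e'0 e'g] : exists2 e' : R, (0 < e')%R & e'%:E <= g n.
    move: (g0 _ Dn); case: (g n) => [s|//|//].
    - by rewrite lte_fin; exists s.
    - by exists 1%R; rewrite ?leey.
  exists (Num.min e e') => [|i]; first by rewrite lt_min e0.
  rewrite ltnS leq_eqVlt => /predU1P[-> _|i_lt Di].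
    by apply: le_trans e'g; rewrite lee_fin ge_min lexx orbT.
  by apply: le_trans (eg _ i_lt Di); rewrite lee_fin ge_min lexx.
by exists e => // i Di; apply: eg => //; exact: Dn.
Qed.

(** * Distance to the closed set *)

Section Distance.
Context {R : realType} {X : Type} {d : X -> X -> \bar R} {A : set X}.
Hypothesis dA : metric_pair d A.
Implicit Types x y a : X.

Lemma pdist_ge0 x y : 0 <= d x y.
Proof. by case: dA => -[]. Qed.

Lemma pdist_refl x : d x x = 0.
Proof. by case: dA => -[]. Qed.

Lemma pdist_sym x y : d x y = d y x.
Proof. by case: dA => -[]. Qed.

Lemma pdist_triangle x y z : d x z <= d x y + d y z.
Proof. by case: dA => -[]. Qed.

Lemma dist_to_ge0 x : 0 <= dist_to d A x.
Proof. by apply: le_ereal_inf_tmp => _ [a _ <-]; exact: pdist_ge0. Qed.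

Lemma dist_to_le x a : A a -> dist_to d A x <= d x a.
Proof. by move=> Aa; apply: ereal_inf_lbound; exists a. Qed.

Lemma dist_to_in x : A x -> dist_to d A x = 0.
Proof.
move=> Ax; apply/eqP; rewrite eq_le dist_to_ge0 andbT -(pdist_refl x).
exact: dist_to_le.
Qed.

(** Closedness of [A]: a point at distance zero would be a limit of points of [A]. *)
Lemma dist_to_gt0 x : ~ A x -> 0 < dist_to d A x.
Proof.
move=> nAx; rewrite lt_neqAle dist_to_ge0 andbT eq_sym; apply/eqP => d0.
apply: nAx; apply: (dA.2) => eps eps0.
have : dist_to d A x < eps%:E by rewrite d0 lte_fin.
by move=> /ereal_inf_lt[_ [a Aa <-] ?]; exists a.
Qed.

Lemma dist_to_triangle x y : dist_to d A x <= d x y + dist_to d A y.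
Proof.
(* An infinite [d x y] is split off, since the rest subtracts it. *)
have [->|dxy] := eqVneq (d x y) +oo.
  by rewrite addye ?leey// gt_eqF// (lt_le_trans _ (dist_to_ge0 y)) ?ltNy0.
have fxy : d x y \is a fin_num by rewrite ge0_fin_numE ?pdist_ge0// lt_neqAle dxy leey.
rewrite -leeBlDl//; apply: le_ereal_inf_tmp => _ [a Aa <-].
by rewrite leeBlDl//; apply: le_trans (pdist_triangle x y a); exact: dist_to_le.
Qed.

(** Without such a point the [e]-neighborhood of [A] would equal [A]. *)
Lemma not_isolated_point (e : R) : ~ isolated_subset d A -> (0 < e)%R ->
  exists2 x, ~ A x & dist_to d A x < e%:E.
Proof.
move=> nA e0; apply: contrapT => nx; apply: nA; exists e%:E; first by rewrite lte_fin.
apply/seteqP; split => [x /= xe|x Ax].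
  by apply: contrapT => nAx; apply: nx; exists x.
by rewrite /thick /= dist_to_in// lte_fin.
Qed.

End Distance.

(** * Compact sets and increasing covers *)

Section Compactness.
Context {R : realType} {X : Type} {d : X -> X -> \bar R} {A : set X} {p : \bar R}.

(** A finite subcover uses boundedly many indices, and by monotonicity the member at the bound
    contains all of its members. *)
Lemma compact_increasing_cover (U : nat -> set (fsum X)) (N : set (fsum X)) :
  (forall n, Wopen d A p (U n)) -> {homo U : m n / (m <= n)%N >-> m `<=` n} ->
  Dp d A p `<=` \bigcup_n U n -> Wcompact d A p N -> exists n, N `<=` U n.
Proof.
move=> Uopen Umono Ucov [NDp /(_ (range U))].
case=> [_ [n _ <-]//||F [Ffin FC NF]].
  by move=> b /NDp /Ucov [n _ Unb]; exists (U n) => //; exists n.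
have [D /finite_set_nat_bounded[n Dn] DF] :
    exists2 D : set nat, finite_set D & F `<=` U @` D.
  (* [g] picks an index for each member of the cover; [0] is only the default off the range of
     [U]. *)
  pose g V := xget 0%N [set n | U n = V].
  exists (g @` F); first exact: finite_image.
  move=> V FV; exists (g V); first by exists V.
  by have [n _ Un] := FC _ FV; apply: (xgetPex 0%N (P := [set n | U n = V])); exists n.
exists n => b /NF[_ /DF[k /Dn kn <-]]; apply: Umono; exact: ltnW.
Qed.

End Compactness.

(** * Adding copies of a point to a formal sum *)

Section AddCopies.
Context {R : realType} {X : Type} {d : X -> X -> \bar R} {A : set X}.

(* Even indices carry [a], odd indices carry [m] copies of [x]: the index set
   of [a] may already be all of [nat]. *)
Definition add_copies (a : fsum X) (m : nat) (x : X) : fsum X :=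
  FSum [set n | if odd n then `I_m n./2 else idx a n./2]
       (fun n => if odd n then x else pt a n./2).

Definition far (t : R) (b : fsum X) : set nat :=
  [set i | idx b i /\ t%:E <= dist_to d A (pt b i)].

Lemma farE (t : R) b : far t b = idx (u_ d A t%:E b).
Proof.
apply/seteqP; split => i /= [bi ti]; split => //; rewrite /thick /=.
  by apply/negP; rewrite -leNgt.
by rewrite leNgt; apply/negP.
Qed.

Lemma add_copies_in_Dbar a m x : ~ A x -> in_Dbar A a ->
  in_Dbar A (add_copies a m x).
Proof. by move=> nAx aD i /=; case: ifP => // _ /aD. Qed.

Lemma finite_restrict_add_copies a m x (B : set X) :
  finite_set (idx (Defs.restrict a B)) -> finite_set (idx (Defs.restrict (add_copies a m x) B)).
Proof.
move=> afin.
apply: (@sub_finite_set _ _ (double @` idx (Defs.restrict a B) `|` (S \o double) @` `I_m)).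
  move=> n /=; have := odd_double_half n.
  by case: (odd n) => /= nE [nidx nB]; [right|left]; exists n./2.
by rewrite finite_setU; split; apply: finite_image => //; exact: finite_II.
Qed.

(** Each point of [a] is paired with itself at the doubled index and each added copy of [x] with
    [a0], so only the copies cost anything. *)
Lemma add_copies_matching a m x a0 : A a0 ->
  is_matching A a (add_copies a m x) (idx a) double (fun=> a0) (fun=> a0).
Proof.
move=> Aa0; split => //.
- by move=> i j _ _; exact: double_inj.
- by move=> _ [i ai <-] /=; rewrite odd_double doubleK.
Qed.

Lemma add_copies_unmatched a m x :
  idx (add_copies a m x) `\` double @` idx a = (fun i => i.*2.+1) @` `I_m.
Proof.
apply/seteqP; split => [n [/= + nim]|_ [i im <-]] /=.
  have := odd_double_half n; case: (odd n) => /= nE nidx; first by exists n./2.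
  by case: nim; exists n./2.
rewrite odd_double /= uphalf_double; split => // -[j _] /(congr1 odd) /=.
by rewrite !odd_double.
Qed.

End AddCopies.
Arguments far {R X}.

(** * The case of infinite exponent *)

Section BottleneckCase.
Context {R : realType} {X : Type} {d : X -> X -> \bar R} {A : set X}.
Hypothesis dA : metric_pair d A.

Lemma mcost_oo_le (b c : fsum X) K phi z w (r : \bar R) : 0 <= r ->
  (forall k, K k -> d (pt b k) (pt c (phi k)) <= r) ->
  (forall i, (idx b `\` K) i -> d (pt b i) (z i) <= r) ->
  (forall j, (idx c `\` phi @` K) j -> d (w j) (pt c j) <= r) ->
  mcost d +oo b c K phi z w <= r.
Proof.
move=> r0 H1 H2 H3; apply: ge_ereal_sup => s.
by move=> [[[->//|[k Kk <-]]|[i bi <-]]|[j cj <-]]; auto.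
Qed.

(** A point of [c] at distance at least [t'] from [A] cannot be unmatched, as it would cost at least
    [t']. Its partner is less than [t' - t] away, hence at distance at least [t] from [A]. So the
    [phi]-image of the far points of [b] contains those of [c]. *)
Lemma far_card_le (b c : fsum X) K phi z w (t t' : R) :
  is_matching A b c K phi z w -> (0 < t < t')%R ->
  mcost d +oo b c K phi z w < (t' - t)%:E -> (far d A t' c #<= far d A t b)%card.
Proof.
move=> [Kb phi_inj phiK zA wA] /andP[t0 tt'] cost.
apply: card_le_trans (card_image_le phi _); apply: subset_card_le => j [cj t'j].
have [[k Kk phikj]|nKj] := pselect ((phi @` K) j); last first.
  have : d (w j) (pt c j) < (t' - t)%:E.
    by apply: le_lt_trans cost; apply: ereal_sup_ubound; right; exists j.
  rewrite (pdist_sym dA) => /(le_lt_trans (dist_to_le _ _ (wA _ (conj cj nKj)))).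
  by move=> /(le_lt_trans t'j); rewrite lte_fin; lra.
exists k => //; split; first exact: Kb.
have dk : d (pt b k) (pt c (phi k)) < (t' - t)%:E.
  by apply: le_lt_trans cost; apply: ereal_sup_ubound; left; left; right; exists k.
have := dist_to_triangle dA (pt c j) (pt b k).
rewrite (pdist_sym dA) -phikj => /(le_trans _) tri.
move: t'j; rewrite -phikj => /tri.
move: dk (pdist_ge0 dA (pt b k) (pt c (phi k))).
case: (d _ _) => [u| |] // dk _.
have := dist_to_ge0 dA (pt b k); case: (dist_to _ _ _) => [v _| |] //; last first.
  by move=> _ _; exact: leey.
move: dk; rewrite -EFinD !lee_fin lte_fin; lra.
Qed.

Definition few_far (s : R) (n : nat) : set (fsum X) :=
  [set b | Dp d A +oo b /\
     exists2 t : R, (0 < t < s)%R & (far d A t b #<= `I_n)%card].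

(** A radius of half the gap [s - t] lets the threshold rise to the midpoint, still below [s]. *)
Lemma few_far_open s n : Wopen d A +oo (few_far s n).
Proof.
split => [b []//|b [Db [t /andP[t0 ts] tn]]].
exists ((s - t) / 2)%R; first by lra.
move=> c [Dc /ereal_inf_lt[_ [K [phi [z [w [mat ->]]]]] cost]]; split => //.
exists ((s + t) / 2)%R; first by lra.
apply: card_le_trans tn; apply: far_card_le mat _ _; first by lra.
by apply: lt_le_trans cost _; rewrite lee_fin; lra.
Qed.

Lemma no_compact_ball_oo (a : fsum X) (r : R) (N : set (fsum X)) :
  ~ isolated_subset d A -> Dp d A +oo a -> (0 < r)%R ->
  Wball d A +oo a r `<=` N -> ~ Wcompact d A +oo N.
Proof.
move=> nA [aD afin] r0 ballN Ncpt.
have [x nAx xr] := not_isolated_point dA r nA r0.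
have [_ [a0 Aa0 <-] dxa0] := ereal_inf_lt xr.
have [s s0 sx] : exists2 s : R, (0 < s)%R & s%:E = dist_to d A x.
  move: xr (dist_to_gt0 dA x nAx); case: (dist_to _ _ _) => [s|//|//] _.
  by rewrite lte_fin; exists s.
have [n Nn] : exists n, N `<=` few_far s n.
  apply: compact_increasing_cover Ncpt; first exact: few_far_open.
    move=> m n mn b [Db [t t0s bm]]; split => //; exists t => //.
    by apply: card_le_trans bm _; rewrite card_le_II.
  (* Any positive threshold below [s] leaves finitely many far points; [s / 2] is one. *)
  move=> b Db; have /finite_set_leP[n bn] : finite_set (far d A (s / 2) b).
    by rewrite farE; apply: Db.2; lra.
  by exists n => //; split => //; exists (s / 2)%R => //; lra.
(* One copy more than [few_far s n] permits; the cost is a supremum, so it stays at most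
   [d x a0 < r] whatever the multiplicity. *)
have /ballN/Nn[_ [t /andP[t0 ts]]] : Wball d A +oo a r (add_copies a n.+1 x).
  split; first split.
  - exact: add_copies_in_Dbar.
  - by move=> delta delta0; apply: finite_restrict_add_copies; exact: afin.
  - apply: le_lt_trans dxa0; apply: (@le_trans _ _
      (mcost d +oo a (add_copies a n.+1 x) (idx a) double (fun=> a0) (fun=> a0))).
      apply: ereal_inf_lbound; exists (idx a), double, (fun=> a0), (fun=> a0).
      by split => //; exact: add_copies_matching.
    apply: mcost_oo_le; first exact: pdist_ge0 dA _ _.
    + by move=> k _ /=; rewrite odd_double doubleK (pdist_refl dA) (pdist_ge0 dA).
    + by move=> k [].
    + rewrite add_copies_unmatched => _ [j _ <-] /=.
      by rewrite odd_double (pdist_sym dA).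
(* All [n.+1] copies lie at distance [s > t] from [A], against the bound [n]. *)
move=> farn; suff : (`I_n.+1 #<= `I_n)%card by rewrite card_le_II ltnn.
apply: card_le_trans farn.
have inj : {in `I_n.+1 &, injective (fun i => i.*2.+1)}.
  by move=> i j _ _ [] /double_inj.
move: (inj_card_eq inj); rewrite card_eq_le => /andP[_ /card_le_trans]; apply.
apply: subset_card_le => _ [i im <-]; rewrite /far /= odd_double uphalf_double.
by split => //; rewrite -sx lee_fin ltW.
Qed.

End BottleneckCase.

(** * Sums of extended reals *)

Section ExtendedRealSums.
Context {R : realType}.

Lemma subset_esum {T : choiceType} (P Q : set T) (f : T -> \bar R) :
  P `<=` Q -> \esum_(i in P) f i <= \esum_(i in Q) f i.
Proof.
move=> PQ; apply: ge_ereal_sup => _ [F [Ffin FP] <-].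
by apply: ereal_sup_ubound; exists F => //; split => //; exact: subset_trans FP PQ.
Qed.

Lemma esum_ge1 {T : choiceType} (P : set T) (f : T -> \bar R) i :
  (forall j, 0 <= f j) -> P i -> f i <= \esum_(j in P) f j.
Proof.
move=> f0 Pi; rewrite -[leLHS](@esum_set1 _ _ i f)//.
by apply: subset_esum => _ ->.
Qed.

Lemma esum_scale_le {T : choiceType} (P : set T) (f : T -> \bar R) (c : \bar R) :
  0 <= c -> (forall i, 0 <= f i) ->
  \esum_(i in P) (c * f i) <= c * \esum_(i in P) f i.
Proof.
move=> c0 f0; apply: ge_ereal_sup => _ [F FP <-].
rewrite -ge0_mule_fsumr//; apply: lee_wpmul2l => //.
by apply: ereal_sup_ubound; exists F.
Qed.

Lemma esum_II_const (m : nat) (c : R) :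
  (0 <= c)%R -> \esum_(i in `I_m) c%:E = (m%:R * c)%:E.
Proof.
move=> c0; rewrite esum_fset//.
by rewrite -fsbig_ord sumEFin sumr_const card_ord mulr_natl.
Qed.

(** Splitting by parity, for index sets of the shape used in [add_copies]. *)
Lemma esum_interleave (P Q : set nat) (f : nat -> \bar R) :
  (forall i, 0 <= f i) ->
  \esum_(n in [set n | if odd n then Q n./2 else P n./2]) f n =
  \esum_(i in P) f i.*2 + \esum_(i in Q) f i.*2.+1.
Proof.
move=> f0; rewrite (esumID [set n | ~~ odd n])//; congr (_ + _).
  rewrite -(@esum_image _ _ _ P double); last by move=> i j _ _; exact: double_inj.
  congr (esum _ f); apply/seteqP; split => [n /= [+ no]|_ [i Pi <-]] /=.
    rewrite (negbTE no) => Pn; exists n./2 => //.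
    by rewrite -[RHS]odd_double_half (negbTE no).
  by rewrite odd_double doubleK.
rewrite -(@esum_image _ _ _ Q (fun i => i.*2.+1)); last first.
  by move=> i j _ _ [] /double_inj.
congr (esum _ f); apply/seteqP; split => [n /= [+ /negP]|_ [i Pi <-]] /=.
  rewrite negbK => + no; rewrite no => Qn; exists n./2 => //.
  by rewrite -[RHS]odd_double_half no.
by rewrite odd_double uphalf_double.
Qed.

(** A finite partial sum comes within [e] of the supremum, so what it omits sums to less than
    [e]. *)
Lemma esum_tail {T : choiceType} (P : set T) (f : T -> \bar R) (e : R) :
  (0 < e)%R -> (forall i, 0 <= f i) -> \esum_(i in P) f i < +oo ->
  exists F : set T, [/\ finite_set F, F `<=` P & \esum_(i in P `\` F) f i < e%:E].
Proof.
move=> e0 f0 Pfin; have Pge0 : 0 <= \esum_(i in P) f i by exact: esum_ge0.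
have PfinE : \esum_(i in P) f i \is a fin_num by rewrite ge0_fin_numE.
have : \esum_(i in P) f i - e%:E < \esum_(i in P) f i.
  by rewrite lteBlDr// lteDl// lte_fin.
move=> /ereal_sup_gt[_ [F [Ffin FP] <-]]; rewrite -esum_fset// => Fe.
exists F; split => //; move: Fe.
rewrite {1}(esumID F)// (setIidr FP).
have le1 : \esum_(i in F) f i <= \esum_(i in P) f i by exact: subset_esum.
have le2 : \esum_(i in P `&` ~` F) f i <= \esum_(i in P) f i.
  by apply: subset_esum => i [].
have := esum_ge0 (fun i (_ : F i) => f0 i); rewrite setDE.
have := esum_ge0 (fun i (_ : (P `&` ~` F) i) => f0 i).
move: (le_lt_trans le1 Pfin) (le_lt_trans le2 Pfin).
case: (esum F f) => [u| |]//; case: (esum _ f) => [v| |]// _ _ _ _.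
by rewrite -EFinD -EFinB !lte_fin; lra.
Qed.

End ExtendedRealSums.

(** * Powers of extended reals *)

Section Powers.
Context {R : realType} {r : R}.
Hypothesis r_gt0 : (0 < r)%R.
Implicit Types (x h : \bar R).

Lemma ge0_le_poweR x y : 0 <= x -> x <= y -> x `^ r <= y `^ r.
Proof.
move=> x0 xy; apply: gt0_ler_poweR => //; first exact: ltW.
- by rewrite in_itv /= x0 leey.
- by rewrite in_itv /= (le_trans x0 xy) leey.
Qed.

Lemma poweR_lt_inv x (s : R) : (0 <= s)%R -> x `^ r < (s `^ r)%R%:E -> x < s%:E.
Proof.
move=> s0; rewrite !ltNge; apply: contra => sx.
by rewrite -poweR_EFin; apply: ge0_le_poweR.
Qed.

(** If [h <= t x] then [x + h <= (1 + t) x]; otherwise [x + h <= (1 + t^-1) h]. One term thus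
    suffices in each case. For small [t] the factor of [x] is close to 1, so a strict bound can
    survive it. *)
Lemma poweR_add_le x h (t : R) : 0 <= x -> 0 <= h -> (0 < t)%R ->
  (x + h) `^ r <= ((1 + t) `^ r)%R%:E * x `^ r + ((1 + t^-1) `^ r)%R%:E * h `^ r.
Proof.
move=> x0 h0 t0.
have [htx|/ltW txh] := leP h (t%:E * x).
  apply: (@le_trans _ _ (((1 + t) `^ r)%R%:E * x `^ r)); last first.
    by rewrite leeDl// mule_ge0// ?lee_fin ?powR_ge0 ?poweR_ge0.
  rewrite -poweR_EFin -poweRM ?lee_fin//; last lra.
  apply: ge0_le_poweR; first exact: adde_ge0.
  rewrite EFinD ge0_muleDl ?lee_fin ?(ltW t0)// mul1e.
  exact: leeD2l.
apply: (@le_trans _ _ (((1 + t^-1) `^ r)%R%:E * h `^ r)); last first.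
  by rewrite leeDr// mule_ge0// ?lee_fin ?powR_ge0 ?poweR_ge0.
have tV0 : (0 < t^-1)%R by rewrite invr_gt0.
rewrite -poweR_EFin -poweRM ?lee_fin//; last lra.
apply: ge0_le_poweR; first exact: adde_ge0.
rewrite EFinD ge0_muleDl ?lee_fin ?(ltW tV0)// mul1e addeC leeD2l//.
by rewrite -(invrK t) lee_pdivrMl// in txh.
Qed.

Lemma exists_powR_mul_lt (s e : R) : (0 <= s < e)%R ->
  exists2 t : R, (0 < t)%R & ((1 + t) `^ r * s < e)%R.
Proof.
(* The midpoint [s'] is positive even when [s = 0]; the witness [t] solves [(1 + t)^r = e / s']. *)
move=> /andP[s0 se]; pose s' := ((s + e) / 2)%R.
have s'0 : (0 < s')%R by rewrite /s'; lra.
have es' : (1 < e / s')%R by rewrite ltr_pdivlMr// /s'; lra.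
exists ((e / s') `^ r^-1 - 1)%R.
  rewrite subr_gt0; have {1}-> : (1 = 1 `^ r^-1 :> R)%R by rewrite powR1.
  by rewrite gt0_ltr_powR ?invr_gt0// nnegrE; lra.
rewrite addrC subrK -powRrM mulVf ?gt_eqF// powRr1; last lra.
by rewrite mulrAC ltr_pdivrMr// ltr_pM2l /s'; lra.
Qed.

End Powers.

(** * The case of finite exponent *)

Section FiniteExponentCase.
Context {R : realType} {X : Type} {d : X -> X -> \bar R} {A : set X} {r : R}.
Hypotheses (dA : metric_pair d A) (r_ge1 : (1 <= r)%R).

Let r_gt0 : (0 < r)%R. Proof. exact: lt_le_trans r_ge1. Qed.
Let rV_gt0 : (0 < r^-1)%R. Proof. by rewrite invr_gt0. Qed.

(** The [r]-th power of the cost, which is additive over the pairs. *)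
Definition pcost (b c : fsum X) K phi z w : \bar R :=
  \esum_(k in K) d (pt b k) (pt c (phi k)) `^ r
  + \esum_(i in idx b `\` K) d (pt b i) (z i) `^ r
  + \esum_(j in idx c `\` phi @` K) d (w j) (pt c j) `^ r.

Lemma mcostE b c K phi z w :
  mcost d r%:E b c K phi z w = pcost b c K phi z w `^ r^-1.
Proof. by []. Qed.

Lemma pcost_ge0 b c K phi z w : 0 <= pcost b c K phi z w.
Proof. by rewrite !adde_ge0//; apply: esum_ge0 => *; exact: poweR_ge0. Qed.

Lemma mcost_lt b c K phi z w (e : R) : (0 <= e)%R ->
  (mcost d r%:E b c K phi z w < e%:E) = (pcost b c K phi z w < (e `^ r)%R%:E).
Proof.
move=> e0; have e_root : ((e `^ r) `^ r^-1)%R = e.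
  by rewrite -powRrM mulfV ?gt_eqF// powRr1.
rewrite mcostE; apply/idP/idP; last first.
  rewrite -{2}e_root => h; apply: (poweR_lt_inv r_gt0); first exact: powR_ge0.
  by rewrite e_root -poweRrM mulVf ?gt_eqF// poweRe1// pcost_ge0.
by rewrite -{1}e_root; apply: (poweR_lt_inv rV_gt0); exact: powR_ge0.
Qed.

(** Amounts to the [r]-th power of $W_r(\ell_t(b),0)$, written without matchings. *)
Definition near_mass (t : R) (b : fsum X) : \bar R :=
  \esum_(i in [set i | idx b i /\ dist_to d A (pt b i) < t%:E])
    dist_to d A (pt b i) `^ r.

(** The points of [c] near [A] are matched or unmatched. A matched one has its partner within [t']
    of [A], and [poweR_add_le] applies to the pair. An unmatched one is at least as far from its
    partner in [A] as from [A], so the cost pays for it. *)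
Lemma near_mass_le (b c : fsum X) K phi z w (t t' s : R) :
  is_matching A b c K phi z w -> (t < t')%R -> (0 < s)%R ->
  pcost b c K phi z w < ((t' - t) `^ r)%R%:E ->
  near_mass t c <= ((1 + s) `^ r)%R%:E * near_mass t' b
                   + ((1 + s^-1) `^ r)%R%:E * pcost b c K phi z w.
Proof.
move=> [Kb phi_inj phiK zA wA] tt' s0 cost.
set C := ((1 + s^-1) `^ r)%R; set Q := ((1 + s) `^ r)%R.
have sV0 : (0 < s^-1)%R by rewrite invr_gt0.
have Q0 : (0 <= Q)%R by exact: powR_ge0.
(* Unmatched points enter with coefficient 1; [C >= 1] absorbs them into the cost term. *)
have C1 : (1 <= C)%R.
  have {1}-> : (1 = 1 `^ r :> R)%R by rewrite powR1.
  by rewrite /C ge0_ler_powR ?nnegrE ?(ltW r_gt0)//; lra.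
have C0 : (0 <= C)%R by lra.
pose J := [set j | idx c j /\ dist_to d A (pt c j) < t%:E].
pose K' := K `&` phi @^-1` J.
have dp0 j : 0 <= dist_to d A (pt c j) `^ r by exact: poweR_ge0.
rewrite /near_mass (esumID (phi @` K))// /pcost -addeA ge0_muleDr; last 2 first.
- by apply: esum_ge0 => *; exact: poweR_ge0.
- by rewrite adde_ge0//; apply: esum_ge0 => *; exact: poweR_ge0.
rewrite addeA; apply: leeD.
  have -> : J `&` phi @` K = phi @` K'.
    apply/seteqP; split => [j [Jj [k Kk kj]]|_ [k [Kk Jk] <-]].
      by exists k => //; split => //=; rewrite kj.
    by split => //; exists k.
  rewrite esum_image; last first.
    by move=> i j /set_mem[Ki _] /set_mem[Kj _]; apply: phi_inj; apply/mem_set.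
  have step k : K' k -> dist_to d A (pt c (phi k)) `^ r <=
      Q%:E * dist_to d A (pt b k) `^ r + C%:E * d (pt b k) (pt c (phi k)) `^ r.
    move=> _.
    apply: le_trans (poweR_add_le r_gt0 _ _ s (dist_to_ge0 dA _) (pdist_ge0 dA _ _) s0).
    apply: (ge0_le_poweR r_gt0); first exact: (dist_to_ge0 dA).
    by rewrite addeC (pdist_sym dA); exact: (dist_to_triangle dA).
  apply: (le_trans (le_esum step)).
  rewrite esumD; last 2 first.
  - by move=> *; rewrite mule_ge0 ?poweR_ge0 ?lee_fin.
  - by move=> *; rewrite mule_ge0 ?poweR_ge0 ?lee_fin.
  apply: leeD; (apply: le_trans; [apply: esum_scale_le => *; rewrite ?poweR_ge0 ?lee_fin//|]);
    (apply: lee_wpmul2l; [by rewrite lee_fin|]); apply: subset_esum; last by move=> k [].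
  move=> k [Kk [_ Jk]]; split; first exact: Kb.
  (* A single pair costs less than [t' - t], so its end in [b] stays within [t'] of [A]. *)
  have dk : d (pt b k) (pt c (phi k)) < (t' - t)%:E.
    apply: (poweR_lt_inv r_gt0); first lra.
    apply: le_lt_trans cost.
    apply: le_trans (esum_ge1 _ (fun k => d (pt b k) (pt c (phi k)) `^ r) k _ Kk) _.
      by move=> j; exact: poweR_ge0.
    rewrite /pcost -addeA leeDl// adde_ge0//; apply: esum_ge0 => *; exact: poweR_ge0.
  apply: le_lt_trans (dist_to_triangle dA _ (pt c (phi k))) _.
  have -> : t' = ((t' - t) + t)%R by lra.
  by rewrite EFinD lteD.
(* Unmatched points, bounded by the last sum of [pcost]. *)
rewrite ge0_muleDr; last 2 first.
- by apply: esum_ge0 => *; exact: poweR_ge0.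
- by apply: esum_ge0 => *; exact: poweR_ge0.
apply: (@le_trans _ _ (C%:E * \esum_(j in idx c `\` phi @` K) d (w j) (pt c j) `^ r)); last first.
  by rewrite leeDr// mule_ge0 ?lee_fin//; apply: esum_ge0 => *; exact: poweR_ge0.
apply: (@le_trans _ _ (\esum_(j in idx c `\` phi @` K) d (w j) (pt c j) `^ r)); last first.
  by rewrite lee_pemull ?lee_fin//; apply: esum_ge0 => *; exact: poweR_ge0.
apply: (@le_trans _ _ (\esum_(j in J `&` ~` (phi @` K)) d (w j) (pt c j) `^ r)); last first.
  by apply: subset_esum => j [[]].
apply: le_esum => j [[cj _] nKj]; apply: (ge0_le_poweR r_gt0); first exact: (dist_to_ge0 dA).
by rewrite (pdist_sym dA); apply: dist_to_le; apply: wA.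
Qed.

Definition small_near_mass (e : R) (n : nat) : set (fsum X) :=
  [set b | Dp d A r%:E b /\
     exists2 t : R, (n.+1%:R^-1 < t)%R & near_mass t b < e%:E].

Lemma small_near_mass_open (e : R) n : Wopen d A r%:E (small_near_mass e n).
Proof.
split => [b []//|b [Db [t' nt' mass_b]]].
(* The threshold is lowered from [t'] to a midpoint still above [n.+1%:R^-1]. *)
set t := ((n.+1%:R^-1 + t') / 2)%R.
have nt : (n.+1%:R^-1 < t)%R by rewrite midf_lt.
have tt' : (t < t')%R by rewrite midf_lt.
have [m m0 mE] : exists2 m : R, (0 <= m)%R & m%:E = near_mass t' b.
  have : 0 <= near_mass t' b by apply: esum_ge0 => *; exact: poweR_ge0.
  by move: mass_b; case: (near_mass t' b) => [m|//|//] _; rewrite lee_fin; exists m.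
move: mass_b; rewrite -mE lte_fin => me.
have [s s0 se] : exists2 s : R, (0 < s)%R & ((1 + s) `^ r * m < e)%R.
  by apply: exists_powR_mul_lt => //; rewrite m0.
set C := ((1 + s^-1) `^ r)%R.
have C0 : (0 < C)%R by apply: powR_gt0; rewrite addr_gt0// invr_gt0.
pose g := ((e - (1 + s) `^ r * m) / C)%R.
have g0 : (0 < g)%R by rewrite divr_gt0// subr_gt0.
(* The first bound is what [near_mass_le] requires; the second keeps [C] times the [r]-th power of
   the cost below the slack [e - (1 + s)^r m]. *)
exists (Num.min (t' - t) (g `^ r^-1))%R.
  by rewrite lt_min subr_gt0 tt' powR_gt0.
move=> c [Dc /ereal_inf_lt[_ [K [phi [z [w [mat ->]]]]]]].
rewrite EFin_min lt_min => /andP[].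
rewrite !mcost_lt ?powR_ge0 ?subr_ge0 ?(ltW tt')//.
rewrite -powRrM mulVf ?gt_eqF// powRr1 ?(ltW g0)// => cost1 cost2; split => //.
exists t => //.
apply: le_lt_trans (near_mass_le _ _ _ _ _ _ _ _ s mat tt' s0 cost1) _; rewrite -mE -/C.
have costfin : pcost b c K phi z w \is a fin_num.
  by rewrite ge0_fin_numE ?pcost_ge0// (lt_trans cost2) ?ltry.
move: cost2; rewrite -(fineK costfin) lte_fin -EFinM -EFinM -EFinD lte_fin.
by rewrite /g ltr_pdivlMr// mulrC ltrBrDl.
Qed.

Lemma small_near_mass_mono (e : R) : {homo small_near_mass e : m n / (m <= n)%N >-> m `<=` n}.
Proof.
move=> m n mn b [Db [t mt mass]]; split => //; exists t => //.
by apply: le_lt_trans mt; rewrite lef_pV2 ?posrE// ler_nat.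
Qed.

(** A matching with the empty sum has [K] empty and sends every point into [A]; its finite cost
    dominates the distances to [A]. *)
Lemma Dp_near_mass_fin (b : fsum X) : Dp d A r%:E b ->
  \esum_(i in idx (l_ d A +oo b)) dist_to d A (pt b i) `^ r < +oo.
Proof.
move=> [_ [_ /ereal_inf_lt[_ [K [phi [z [w [[_ _ phiK zA _] ->]]]]]]]].
have K0 : K = set0 by rewrite -subset0 => k Kk; apply: (phiK (phi k)); exists k.
rewrite mcostE => /(lty_poweRy (lt0r_neq0 rV_gt0)); apply: le_lt_trans.
rewrite /pcost -addeA; apply: le_trans (leeDr _ _); last first.
  by apply: esum_ge0 => *; exact: poweR_ge0.
apply: le_trans (leeDl _ _); last by apply: esum_ge0 => *; exact: poweR_ge0.
move: zA; rewrite K0 setD0 => zA; apply: le_esum => i bi.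
by apply: (ge0_le_poweR r_gt0); [exact: (dist_to_ge0 dA)|apply: dist_to_le; exact: zA].
Qed.

(** All but finitely many of the points at finite distance from [A] have total below [e], and a
    threshold not exceeding the distances of the exceptional ones excludes them. *)
Lemma small_near_mass_cover (e : R) : (0 < e)%R ->
  Dp d A r%:E `<=` \bigcup_n small_near_mass e n.
Proof.
move=> e0 b Db.
have [F [Ffin Fl Fe]] := esum_tail _ _ _ e0 (fun i => poweR_ge0 _ _) (Dp_near_mass_fin _ Db).
have [t t0 tF] : exists2 t : R, (0 < t)%R & forall i, F i -> t%:E <= dist_to d A (pt b i).
  apply: finite_set_gt0_lbound => // i /Fl[bi _]; apply: (dist_to_gt0 dA).
  exact: Db.1.
exists (Num.truncn t^-1) => //; split => //; exists t.
  by rewrite invf_plt ?posrE// truncnS_gt.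
apply: le_lt_trans Fe; apply: subset_esum => i [bi it]; split.
  by split => //; split; [exact: lt_trans it (ltry _)|exact: Db.1].
by move=> /tF; rewrite leNgt it.
Qed.

Lemma add_copies_pcost a m x a0 :
  pcost a (add_copies a m x) (idx a) double (fun=> a0) (fun=> a0) =
  \esum_(i in `I_m) d a0 x `^ r.
Proof.
rewrite /pcost esum1; last first.
  by move=> k _; rewrite /= odd_double doubleK (pdist_refl dA) poweR0r// gt_eqF.
rewrite setDv esum_set0 !add0e add_copies_unmatched esum_image; last first.
  by move=> i j _ _ [] /double_inj.
by apply: eq_esum => i _; rewrite /= odd_double.
Qed.

Lemma add_copies_Dp a m x a0 : Dp d A r%:E a -> ~ A x -> A a0 -> d x a0 < +oo ->
  Dp d A r%:E (add_copies a m x).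
Proof.
move=> [aD [afin /ereal_inf_lt[_ [K [phi [z [w [[_ _ phiK zA _] ->]]]]] cost]]] nAx Aa0 dxa0.
have K0 : K = set0 by rewrite -subset0 => k Kk; apply: (phiK (phi k)); exists k.
move: cost; rewrite mcostE => /(lty_poweRy (lt0r_neq0 rV_gt0)) cost.
split; first exact: add_copies_in_Dbar.
split; first exact: finite_restrict_add_copies.
(* Points of [a] keep their partners in [A]; the copies go to [a0], adding the finite amount
   [m * d x a0 ^ r]. *)
pose z' n := if odd n then a0 else z n./2.
have lD n : idx (l_ d A +oo (add_copies a m x)) n ->
    if odd n then `I_m n./2 else idx (l_ d A +oo a) n./2.
  by move=> /= []; case: (odd n).
apply: le_lt_trans (_ : mcost d r%:E (l_ d A +oo (add_copies a m x))
  (zero_like (l_ d A +oo (add_copies a m x))) set0 id z' (fun=> a0) < +oo).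
  apply: ereal_inf_lbound; exists set0, id, z', (fun=> a0); split => //; split => //.
  - by rewrite image_set0.
  - move=> n [/lD + _]; rewrite /z'; case: (odd n) => // an; apply: zA.
    by rewrite K0 setD0.
rewrite mcostE; apply: poweR_lty.
rewrite /pcost esum_set0 add0e image_set0 !setD0 /= esum_set0 adde0.
apply: (@le_lt_trans _ _ (\esum_(n in [set n | if odd n then `I_m n./2
     else idx (l_ d A +oo a) n./2]) d (pt (add_copies a m x) n) (z' n) `^ r)).
  by apply: subset_esum => n /lD.
rewrite esum_interleave; last by move=> *; exact: poweR_ge0.
rewrite lte_add_pinfty//.
  apply: le_lt_trans cost; rewrite K0 /pcost setD0 esum_set0 add0e.
  rewrite (eq_esum (b := fun i => d (pt a i) (z i) `^ r)).
    by rewrite leeDl//; apply: esum_ge0 => *; exact: poweR_ge0.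
  by move=> i _; rewrite /z' /= odd_double doubleK.
rewrite (eq_esum (b := fun=> d x a0 `^ r)); last first.
  by move=> i _; rewrite /z' /= odd_double.
have : d x a0 \is a fin_num by rewrite ge0_fin_numE// (pdist_ge0 dA).
by move=> /fineK <-; rewrite poweR_EFin esum_II_const ?powR_ge0// ltry.
Qed.

Lemma add_copies_near_mass a m x (t s : R) :
  dist_to d A x = s%:E -> (s < t)%R -> (m%:R * s `^ r)%R%:E <= near_mass t (add_copies a m x).
Proof.
move=> xs st; rewrite -esum_II_const ?powR_ge0//.
apply: (@le_trans _ _ (\esum_(n in (fun i => i.*2.+1) @` `I_m)
    dist_to d A (pt (add_copies a m x) n) `^ r)).
  rewrite esum_image; last by move=> i j _ _ [] /double_inj.
  by apply: le_esum => i _; rewrite /= odd_double xs poweR_EFin.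
by apply: subset_esum => _ [i im <-]; rewrite /= odd_double uphalf_double xs lte_fin.
Qed.

Lemma no_compact_ball_fin (a : fsum X) (e : R) (N : set (fsum X)) :
  ~ isolated_subset d A -> Dp d A r%:E a -> (0 < e)%R ->
  Wball d A r%:E a e `<=` N -> ~ Wcompact d A r%:E N.
Proof.
move=> nA Da e0 ballN Ncpt.
(* Chosen so that [2^r * 2M = e^r]. *)
pose M := ((e / 2) `^ r / 2)%R.
have M0 : (0 < M)%R by rewrite divr_gt0// powR_gt0// divr_gt0.
have [n Nn] : exists n, N `<=` small_near_mass M n.
  apply: compact_increasing_cover Ncpt; first exact: small_near_mass_open.
    exact: small_near_mass_mono.
  exact: small_near_mass_cover.
(* The first bound puts [x] below every threshold allowed in [small_near_mass M n]; the second gives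
   [s^r < M], so the copies can overshoot [M] by less than a factor 2. *)
have h0 : (0 < Num.min n.+1%:R^-1 (M `^ r^-1))%R.
  by rewrite lt_min powR_gt0// invr_gt0 ltr0n.
have [x nAx] := not_isolated_point dA _ nA h0.
have := dist_to_gt0 dA _ nAx.
case xs: (dist_to d A x) => [s|//|//]; rewrite !lte_fin lt_min => s0 /andP[sn sM].
(* The infimum [s] need not be attained; [2 * s] exceeds it since [s > 0]. *)
have [_ [a0 Aa0 <-] dxa0] : exists2 v, [set d x y | y in A] v & v < (2 * s)%:E.
  by apply: ereal_inf_lt; rewrite -/(dist_to d A x) xs lte_fin; lra.
have sr0 : (0 < s `^ r)%R by exact: powR_gt0.
have srM : (s `^ r < M)%R.
  have -> : M = ((M `^ r^-1) `^ r)%R by rewrite -powRrM mulVf ?gt_eqF// powRr1// ltW.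
  by rewrite gt0_ltr_powR// nnegrE ?powR_ge0// ltW.
(* The number of copies: smallest m with m s^r > M, so that also
   m (2s)^r <= 2^r (M + s^r) < 2^(r+1) M = e^r. *)
pose m := (Num.truncn (M / s `^ r)).+1.
have mM : (M < m%:R * s `^ r)%R by rewrite -ltr_pdivrMr// truncnS_gt.
have mM2 : (m%:R * s `^ r < 2 * M)%R.
  rewrite mulr2n mulrDl mul1r -natr1 mulrDl mul1r ler_ltD// -ler_pdivlMr//.
  by rewrite truncn_le// divr_ge0// ltW.
have /ballN/Nn[_ [t nt]] : Wball d A r%:E a e (add_copies a m x).
  split; first by apply: add_copies_Dp Aa0 _ => //; exact: lt_trans dxa0 (ltry _).
  apply: le_lt_trans (_ : mcost d r%:E a (add_copies a m x) (idx a) double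
    (fun=> a0) (fun=> a0) < _).
    apply: ereal_inf_lbound; exists (idx a), double, (fun=> a0), (fun=> a0).
    by split => //; exact: add_copies_matching.
  rewrite mcost_lt ?(ltW e0)// add_copies_pcost (pdist_sym dA).
  apply: le_lt_trans (_ : \esum_(i in `I_m) ((2 * s) `^ r)%R%:E < _).
    apply: le_esum => i _; rewrite -poweR_EFin; apply: (ge0_le_poweR r_gt0).
      exact: (pdist_ge0 dA).
    exact: ltW.
  rewrite esum_II_const ?powR_ge0// lte_fin powRM ?ltW// mulrCA.
  have -> : (e = 2 * (e / 2))%R by lra.
  rewrite powRM ?(ltW e0)//; last lra.
  rewrite ltr_pM2l ?powR_gt0//; apply: lt_le_trans mM2 _.
  by rewrite /M; lra.
(* The copies alone have near mass at least [m s^r > M], a contradiction. *)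
apply/negP; rewrite -leNgt; apply: le_trans (add_copies_near_mass _ _ _ _ _ xs (lt_trans sn nt)).
by rewrite lee_fin ltW.
Qed.

End FiniteExponentCase.

(** * The empty sum and the conclusion *)

Lemma empty_fsum_Dp {R : realType} {X : Type} {d : X -> X -> \bar R} {A : set X}
    (p : \bar R) (a : fsum X) : 1 <= p -> idx a = set0 -> Dp d A p a.
Proof.
move=> p1 a0; have fin B : finite_set (idx (Defs.restrict a B)).
  by rewrite /= a0 set0I; exact: finite_set0.
split; first by move=> i; rewrite a0.
case: p p1 => [r p1|_ delta _|//]; last exact: fin.
split; first exact: fin.
(* [pt a 0] is a default: no index is unmatched, so it need not lie in [A]. *)
apply: le_lt_trans (_ : mcost d r%:E _ _ set0 id (fun=> pt a 0) (fun=> pt a 0) < +oo).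
  apply: ereal_inf_lbound; exists set0, id, (fun=> pt a 0), (fun=> pt a 0).
  by split => //; split => //=; rewrite ?a0 ?image_set0 // => i [] //=; case.
apply: poweR_lty.
by rewrite /= a0 set0I image_set0 !setD0 !esum_set0 !add0e ltry.
Qed.

Theorem theorem7p11 (R : realType) (X : Type) (d : X -> X -> \bar R) (A : set X)
    (p : \bar R) :
  metric_pair d A -> ~ isolated_subset d A -> 1 <= p ->
  [/\ (forall (a : fsum X) (N : set (fsum X)),
         Dp d A p a -> Wnbhd d A p a N -> ~ Wcompact d A p N),
      ~ Wlocally_compact d A p &
      (forall K : set (fsum X), Wcompact d A p K -> Winterior d A p K = set0)].
Proof.
move=> dA nA p1.
have main (a : fsum X) (N : set (fsum X)) :
    Dp d A p a -> Wnbhd d A p a N -> ~ Wcompact d A p N.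
  move=> Da [_ [U [[_ Uopen] Ua UN]]].
  have [e e0 aU] := Uopen _ Ua; have aN := subset_trans aU UN.
  case: p p1 Da {Uopen} aU aN => [r|//|//] p1 Da _ aN.
  - exact: (no_compact_ball_fin dA p1 _ _ _ nA Da e0 aN).
  - exact: (no_compact_ball_oo dA _ _ _ nA Da e0 aN).
split=> //.
(* Local compactness is refuted at the empty sum; non-isolation supplies a point of [X] for its
   point map. *)
- move=> lc; have [x nAx _] := not_isolated_point dA 1%R nA ltr01.
  have D0 : Dp d A p (FSum set0 (fun=> x)) by exact: empty_fsum_Dp.
  by have [N [aN Ncpt]] := lc _ D0; exact: main D0 aN Ncpt.
(* An interior point of [K] would have [K] as a compact neighborhood. *)
- move=> K Kcpt; rewrite -subset0 => a [U [Uopen Ua UK]].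
  by apply: (main a K) => //; [exact: Uopen.1|split; [exact: Kcpt.1|exists U]].
Qed.
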